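(* Let $K$ be a field, $1\le d\le n$, and let $I=I_{n,d}\subset S=K[x_1,\dots,x_n]$ be the squarefree Veronese ideal of degree $d$, generated by all squarefree monomials of degree $d$. Then $d(I,k)=dk$ for all $k\ge1$.
   Context: The $k$th symbolic power is $I^{(k)}=\bigcap_{P\in\mathrm{Ass}(I)}(I^kS_P\cap S)$, with $\mathrm{Ass}(I)=\mathrm{Ass}(S/I)$. The symbolic Rees algebra $\mathcal{R}_s(I)=\bigoplus_{k\ge0}I^{(k)}t^k\subset S[t]$ of a monomial ideal is (known to be) a finitely generated $K$-algebra, with minimal monomial generators $x_1,\dots,x_n,u_1t^{q_1},\dots,u_mt^{q_m}$, where $u_j\in S$ are monomials and $q_j>0$. For $k\ge1$, $d(I,k)=\max\{\sum_{s=1}^mc_s\deg(u_s):(c_1,\dots,c_m)\in\mathbb{Z}_{\ge0}^m,\ c_1q_1+\dots+c_mq_m\le k\}$. (For $I=I_{n,d}$ it is known that $\mathcal{R}_s(I)$ is generated over $S$ by the monomials $x_{i_1}\cdots x_{i_{q+d-1}}t^q$ with $1\le q\le n-d+1$, $i_1<\dots<i_{q+d-1}$.) *)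

(* Defs.v *)
From HB Require Import structures.
From mathcomp Require Import all_boot all_order all_algebra.
From mathcomp Require Import fraction mpoly.
From Stdlib Require Import ClassicalEpsilon.

Set Implicit Arguments.
Unset Strict Implicit.
Unset Printing Implicit Defensive.

Import GRing.Theory.
Local Open Scope ring_scope.

(* Finite sums of products a * g with a in A and g in G. *)
Definition combinations (R : comNzRingType) (A G : R -> Prop) (f : R) : Prop :=
  exists s : seq (R * R),
    (forall p, p \in s -> A p.1 /\ G p.2) /\ f = \sum_(p <- s) p.1 * p.2.

Definition ideal_gen (R : comNzRingType) (G : R -> Prop) : R -> Prop :=
  combinations (fun _ => True) G.

Definition ideal_power (R : comNzRingType) (J : R -> Prop) (k : nat) : R -> Prop :=
  ideal_gen (fun f => exists a : 'I_k -> R,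
    (forall i, J (a i)) /\ f = \prod_(i < k) a i).

Definition is_prime_ideal (R : comNzRingType) (P : R -> Prop) : Prop :=
  [/\ P 0, forall a b, P a -> P b -> P (a + b), forall r a, P a -> P (r * a),
      ~ P 1 & forall a b, P (a * b) -> P a \/ P b].

(* P is an associated prime of R / J: the annihilator of the class of some f. *)
Definition associated_prime (R : comNzRingType) (J P : R -> Prop) : Prop :=
  is_prime_ideal P /\ exists f : R, forall g : R, P g <-> J (g * f).

(* R being a domain, R_P is realised inside the fraction field of R. *)
Definition localization (R : idomainType) (P : R -> Prop)
    (y : {fraction R}) : Prop :=
  exists a s : R, ~ P s /\ y = tofrac a / tofrac s.

Definition extension (R : idomainType) (P J : R -> Prop) : {fraction R} -> Prop :=
  combinations (localization P) (fun y => exists2 a : R, J a & y = tofrac a).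

Definition symbolic_power (R : idomainType) (J : R -> Prop) (k : nat)
    (f : R) : Prop :=
  forall P : R -> Prop,
    associated_prime J P -> extension P (ideal_power J k) (tofrac f).

(* The indeterminate of {poly R} plays the role of t. *)
Definition symbolic_rees (R : idomainType) (J : R -> Prop)
    (F : {poly R}) : Prop :=
  forall k : nat, symbolic_power J k F`_k.

Definition is_subalgebra (K : fieldType) (n : nat)
    (A : {poly {mpoly K[n]}} -> Prop) : Prop :=
  [/\ forall c : K, A (c%:MP)%:P,
      forall F G, A F -> A G -> A (F + G)
    & forall F G, A F -> A G -> A (F * G)].

Definition subalgebra_gen (K : fieldType) (n : nat)
    (G : {poly {mpoly K[n]}} -> Prop) (F : {poly {mpoly K[n]}}) : Prop :=
  forall A, is_subalgebra A -> (forall x, G x -> A x) -> A F.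

(* The pair (u, q) encodes the monomial u t^q of S[t]. *)
Definition monomial_t (K : fieldType) (n : nat) (g : 'X_{1..n} * nat) :
    {poly {mpoly K[n]}} :=
  'X_[g.1] *: 'X^(g.2).

Definition generates_rees (K : fieldType) (n : nat)
    (J : {mpoly K[n]} -> Prop) (gens : seq ('X_{1..n} * nat)) : Prop :=
  forall F, symbolic_rees J F <->
    subalgebra_gen (fun x => exists2 g, g \in gens & x = monomial_t K g) F.

Definition minimal_rees_generators (K : fieldType) (n : nat)
    (J : {mpoly K[n]} -> Prop) (gens : seq ('X_{1..n} * nat)) : Prop :=
  generates_rees J gens /\
  forall s, subseq s gens -> generates_rees J s -> s = gens.

Definition is_maximum (A : nat -> Prop) (v : nat) : Prop :=
  A v /\ forall w, A w -> (w <= v)%N.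

Definition is_symbolic_degree (K : fieldType) (n : nat)
    (J : {mpoly K[n]} -> Prop) (k v : nat) : Prop :=
  exists (m : nat) (u : 'I_m -> 'X_{1..n}) (q : 'I_m -> nat),
    [/\ forall j, (0 < q j)%N,
        minimal_rees_generators J
          ([seq (U_(i)%MM, 0%N) | i <- enum 'I_n] ++
           [seq (u j, q j) | j <- enum 'I_m])
      & is_maximum
          (fun w => exists c : 'I_m -> nat,
             (\sum_(j < m) c j * q j <= k)%N /\
             w = (\sum_(j < m) c j * mdeg (u j))%N) v].

(* d(J, k).  A monomial subalgebra of S[t] has at most one minimal set of
   monomial generators, so at most one v satisfies the predicate. *)
Definition symbolic_degree (K : fieldType) (n : nat)
    (J : {mpoly K[n]} -> Prop) (k : nat) : nat :=
  epsilon (inhabits 0%N) (is_symbolic_degree J k).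

Definition squarefree_veronese (K : fieldType) (n d : nat) :
    {mpoly K[n]} -> Prop :=
  ideal_gen (fun f => exists m : 'X_{1..n},
    [/\ mdeg m = d, forall i, (m i <= 1)%N & f = 'X_[m]]).

(* Main.v *)
Require Import Defs.
From mathcomp Require Import all_boot all_order all_algebra.
From mathcomp Require Import fraction mpoly zify ring.
From Stdlib Require Import Classical ClassicalEpsilon.

(** For a set T of n - d + 1 variables let P_T be the prime that T generates.
    A squarefree monomial of degree d cannot avoid T, and a monomial lies in
    the Veronese ideal I as soon as its support has d elements, so I is the
    intersection of the P_T. Every associated prime of I is contained in some
    P_T and every P_T is associated; comparing localizations, a polynomial lies
    in I^(k) exactly when each of its monomials m has degree at least k in the
    variables of T, for every T ([symbolic_powerP]). The inclusion of I^(k) in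
    this set uses that the T-order is additive on products, which is read off
    from the substitution x_i -> x_i t for i in T.

    The symbolic Rees algebra is therefore spanned by the monomials m t^k with
    (m, k) in an additive monoid M of exponents, and a list of monomials
    generates the algebra iff it generates M ([generates_reesP]). Removing one
    copy of the support of m at a time shows that M is generated by the
    variables and by the squarefree monomials with a support A of at least d
    elements, placed in t-degree q = |A| - d + 1 ([symbolic_mnm_span]).

    For these squarefree generators deg = q + d - 1 <= d q. A generator u t^q
    of an arbitrary generating list with deg u > d q must then be a variable
    times another element of M of t-degree q, so the list without u t^q still
    generates: in a minimal list every generator satisfies deg u <= d q
    ([minimal_gen_mdeg]), whence d(I,k) <= d k. Conversely, some generator of
    t-degree 1 exists, its degree is at least d because it lies in I, and
    taking it k times reaches d k. As the symbolic degree is defined by a choice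
    among the values obtained from minimal generating lists, one such list has
    to be exhibited too: it is cut out of the list above
    ([minimal_gens_exist]). *)

Set Implicit Arguments.
Unset Strict Implicit.
Unset Printing Implicit Defensive.

(** * Finite sets and sequences *)

Lemma subset_of_card (T : finType) (A : {set T}) k :
  k <= #|A| -> exists2 B : {set T}, B \subset A & #|B| = k.
Proof.
move=> kA; exists [set x in take k (enum A)].
  by apply/subsetP=> x; rewrite inE => /mem_take; rewrite mem_enum.
rewrite cardsE (card_uniqP _) ?take_uniq ?enum_uniq //.
by rewrite size_takel // -cardE.
Qed.

(** Descent on the size; P need not be decidable, so whether a shorter list
    exists is decided classically. *)
Lemma minimal_subseq (T : eqType) (P : seq T -> Prop) (s : seq T) :
  P s -> exists t, [/\ subseq t s, P t
    & forall s', subseq s' t -> P s' -> s' = t].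
Proof.
have [N] := ubnP (size s); elim: N s => // N IH s sN Ps.
case: (classic (exists s', [/\ subseq s' s, P s' & s' != s])) => [|noshort].
  case=> s' [s's Ps' ne]; have lt : size s' < size s.
    by rewrite ltn_neqAle size_subseq // andbT size_subseq_leqif.
  have [|t [ts' Pt mint]] := IH s' _ Ps'; first by lia.
  by exists t; split=> //; apply: subseq_trans s's.
exists s; split=> // s' s's Ps'; apply/eqP/negPn/negP => ne.
by case: noshort; exists s'.
Qed.

(** * Monomials in the symbolic powers *)

Section Exponents.

Variable n : nat.
Implicit Types (m u v : 'X_{1..n}) (A T : {set 'I_n}).

Definition setdeg T m : nat := \sum_(i in T) m i.

Lemma setdeg0 T : setdeg T 0%MM = 0.
Proof. by rewrite /setdeg big1 // => i _; rewrite mnm0E. Qed.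

Lemma setdegD T m u : setdeg T (m + u)%MM = setdeg T m + setdeg T u.
Proof. by rewrite /setdeg -big_split; apply: eq_bigr => i _; rewrite mnmDE. Qed.

Lemma setdegU T i : setdeg T U_(i)%MM = (i \in T).
Proof.
rewrite /setdeg; case: (boolP (i \in T)) => iT.
  rewrite (bigD1 i) //= mnm1E eqxx big1 // => j /andP[_ /negPf].
  by rewrite mnm1E eq_sym => ->.
rewrite big1 // => j jT; rewrite mnm1E; apply/eqP; rewrite eqb0.
by apply: contraNneq iT => ->.
Qed.

Lemma setdeg_mesym1 T A : setdeg T (mesym1 A) = #|T :&: A|.
Proof.
rewrite -sum1_card [RHS](eq_bigl (fun i => (i \in T) && (i \in A))); last first.
  by move=> i; rewrite inE.
by rewrite [RHS]big_mkcondr; apply: eq_bigr => i _; rewrite mnmE; case: (i \in A).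
Qed.

Lemma leq_setdeg T T' m : T \subset T' -> setdeg T m <= setdeg T' m.
Proof.
move=> sT; rewrite /setdeg [leqRHS](big_setID T) /= (setIidPr sT).
exact: leq_addr.
Qed.

Definition mnm_supp m : {set 'I_n} := [set i | 0 < m i].

Lemma mesym1_le A m : A \subset mnm_supp m -> (mesym1 A <= m)%MM.
Proof.
move/subsetP=> sA; apply/mnm_lepP=> i; rewrite mnmE.
by case: (boolP (i \in A)) => // /sA; rewrite inE.
Qed.

Lemma squarefree_mesym1 m : (forall i, m i <= 1) -> m = mesym1 (mnm_supp m).
Proof. by move=> sq; apply/mnmP=> i; rewrite mnmE inE; case: (m i) (sq i) => [|[]]. Qed.

Variable d : nat.

(** [symbolic_mnm m k] says that the monomial m lies in the k-th power of P_T
    for every T, i.e. that m t^k belongs to the symbolic Rees algebra. *)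
Definition symbolic_mnm m k : Prop :=
  forall T, #|T| = (n - d).+1 -> k <= setdeg T m.

Lemma symbolic_mnm0 m : symbolic_mnm m 0. Proof. by []. Qed.

Lemma symbolic_mnmD m u k l :
  symbolic_mnm m k -> symbolic_mnm u l -> symbolic_mnm (m + u)%MM (k + l).
Proof. by move=> mk ul T cT; rewrite setdegD leq_add ?mk ?ul. Qed.

Hypothesis dn : d <= n.

Lemma card_setI_geq T A : #|T| = (n - d).+1 -> d <= #|A| -> #|A| - d < #|T :&: A|.
Proof.
move=> cT dA; have := cardsUI T A.
have : #|T :|: A| <= n by rewrite -[leqRHS]card_ord max_card.
move: dn; lia.
Qed.

Lemma symbolic_mesym1 A : d <= #|A| -> symbolic_mnm (mesym1 A) (#|A| - d).+1.
Proof. by move=> dA T cT; rewrite setdeg_mesym1; apply: card_setI_geq. Qed.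

(** A support with fewer than d elements leaves n - d + 1 variables free. *)
Lemma symbolic_supp m : symbolic_mnm m 1 -> d <= #|mnm_supp m|.
Proof.
move=> m1; rewrite leqNgt; apply/negP=> lt.
have [|T /subsetP sT cT] := @subset_of_card _ (~: mnm_supp m) (n - d).+1.
  by have := cardsC (mnm_supp m); rewrite card_ord; lia.
have := m1 T cT; rewrite /setdeg big1 // => i /sT; rewrite !inE.
by case: (m i).
Qed.

Lemma symbolic_mdeg m : symbolic_mnm m 1 -> d <= mdeg m.
Proof.
move=> /symbolic_supp dm; apply: leq_trans dm _.
by rewrite -mdeg_mesym1 -{2}(submK (mesym1_le (subxx (mnm_supp m)))) mdegD leq_addl.
Qed.

(** Subtracting the indicator of the support S costs |T :&: S| on T, which may
    exceed q = |S| - d + 1. It is enough to look at q elements B of T :&: S: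
    together with the complement of S, where m vanishes, they form a set of
    n - d + 1 variables, so B alone carries degree k. *)
Lemma symbolic_peel m k (q := (#|mnm_supp m| - d).+1) : q <= k ->
  symbolic_mnm m k -> symbolic_mnm (m - mesym1 (mnm_supp m))%MM (k - q).
Proof.
move=> qk mk T cT; pose S := mnm_supp m; rewrite -/S.
have dS : d <= #|S| by apply: symbolic_supp => T' cT'; have := mk T' cT'; lia.
have [B BTS cB] : exists2 B : {set 'I_n}, B \subset T :&: S & #|B| = q.
  by apply: subset_of_card; apply: card_setI_geq.
have [BT BS] : B \subset T /\ B \subset S.
  by move: BTS; rewrite subsetI => /andP.
have disj : B :&: ~: S = set0.
  by apply/eqP; rewrite -setDE setD_eq0.
have cBS : #|B :|: ~: S| = (n - d).+1.
  have := cardsUI B (~: S); have := cardsC S; rewrite disj cards0 card_ord.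
  by move: cB dS dn; rewrite /q -/S; lia.
have degBS : setdeg (B :|: ~: S) m = setdeg B m.
  rewrite /setdeg big_mkcond [RHS]big_mkcond; apply: eq_bigr => i _.
  by rewrite !inE; case: (i \in B); case: (m i).
have := leq_setdeg (m - mesym1 S)%MM BT; have := mk _ cBS.
rewrite degBS -{1}(submK (mesym1_le (subxx S))) setdegD setdeg_mesym1.
by rewrite (setIidPl BS) cB; lia.
Qed.

(** * Generators of the monoid of exponents *)

Implicit Types (gens : seq ('X_{1..n} * nat)).

(** The pair (m, k) stands for the monomial m t^k, as in [monomial_t]. *)
Inductive mono_span (G : {pred 'X_{1..n} * nat}) : 'X_{1..n} -> nat -> Prop :=
| mono_span0 : mono_span G 0%MM 0
| mono_span_cons g m k : g \in G -> mono_span G m k ->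
    mono_span G (g.1 + m)%MM (g.2 + k).

Implicit Types (G H : {pred 'X_{1..n} * nat}).

Lemma mono_span_mem G g : g \in G -> mono_span G g.1 g.2.
Proof.
by move=> gG; have := mono_span_cons gG (mono_span0 G); rewrite addm0 addn0.
Qed.

Lemma mono_spanD G m u k l :
  mono_span G m k -> mono_span G u l -> mono_span G (m + u)%MM (k + l).
Proof.
move=> + ul; elim=> [|g {}m {}k gG _ IH]; first by rewrite add0m.
by rewrite -addmA -addnA; apply: mono_span_cons.
Qed.

Lemma mono_span_min G (P : 'X_{1..n} -> nat -> Prop) :
    P 0%MM 0 -> (forall m k u l, P m k -> P u l -> P (m + u)%MM (k + l)) ->
    (forall g, g \in G -> P g.1 g.2) ->
  forall m k, mono_span G m k -> P m k.
Proof. by move=> P0 PD PG m k; elim=> // g {}m {}k gG _; apply: PD (PG g gG). Qed.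

Lemma mono_span_sub G H : (forall g, g \in G -> mono_span H g.1 g.2) ->
  forall m k, mono_span G m k -> mono_span H m k.
Proof.
move=> sub; apply: mono_span_min sub; first exact: mono_span0.
by move=> *; apply: mono_spanD.
Qed.

(** A generator cannot occur in a monomial of smaller degree. *)
Lemma mono_span_lt_mdeg G u q m k :
  mono_span G m k -> mdeg m < mdeg u ->
  mono_span [pred g in G | g != (u, q)] m k.
Proof.
elim=> [_|g {}m {}k gG _ IH]; first exact: mono_span0.
rewrite mdegD => lt; apply: mono_span_cons; last by apply: IH; lia.
rewrite inE gG /=; apply/eqP=> eg; rewrite eg /= in lt; lia.
Qed.

Lemma mono_span_deg1 G m : mono_span G m 1 ->
  exists u, (u, 1) \in G /\ mdeg u <= mdeg m.
Proof.
suff gen k : mono_span G m k -> k = 1 ->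
    exists u, (u, 1) \in G /\ mdeg u <= mdeg m by move=> /gen; apply.
elim=> // -[u [|q]] {}m {}k /= gG _ IH.
  by rewrite mdegD => /IH[v [vG vm]]; exists v; split=> //; lia.
case=> q0; exists u; rewrite mdegD leq_addr; split=> //.
by have <- : q.+1 = 1 by lia.
Qed.

Definition variables : seq ('X_{1..n} * nat) :=
  [seq (U_(i)%MM, 0) | i <- enum 'I_n].

Lemma mem_variables i : (U_(i)%MM, 0) \in variables.
Proof. by apply/mapP; exists i; rewrite ?mem_enum. Qed.

Lemma variablesP g : g \in variables -> exists i, g = (U_(i)%MM, 0).
Proof. by case/mapP=> i _ ->; exists i. Qed.

Lemma mono_span_variables G m : {subset variables <= G} -> mono_span G m 0.
Proof.
move=> sub; move: {2}(mdeg m) (erefl (mdeg m)) => D; elim: D m => [|D IH] m mD.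
  by move/eqP: mD; rewrite mdeg_eq0 => /eqP->; apply: mono_span0.
have [i mi] : exists i, 0 < m i.
  apply: not_all_not_ex => m0; move: mD; rewrite mdegE big1 // => i _.
  by have := m0 i; lia.
have Um : (U_(i) <= m)%MM by rewrite lep1mP -lt0n.
rewrite -(submK Um) addmC -[0]addn0.
apply: (mono_span_cons (sub _ (mem_variables i))) => /=.
by apply: IH; have := mdegD (m - U_(i))%MM U_(i)%MM; rewrite submK // mdeg1; lia.
Qed.

Definition veronese_gens : seq ('X_{1..n} * nat) :=
  [seq (mesym1 A, (#|A| - d).+1) | A <- enum {set 'I_n} & d <= #|A|].

Lemma veronese_gensP g :
  reflect (exists2 A : {set 'I_n}, d <= #|A| & g = (mesym1 A, (#|A| - d).+1))
          (g \in veronese_gens).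
Proof.
apply: (iffP mapP) => [[A]|[A dA ->]].
  by rewrite mem_filter => /andP[dA _] ->; exists A.
by exists A; rewrite // mem_filter dA mem_enum.
Qed.

(** By strong induction on k, some squarefree generator splits off: the full
    support if its t-degree is at most k ([symbolic_peel]), otherwise any
    d + k - 1 elements of the support, which use up the whole t-degree. *)
Lemma symbolic_mnm_span m k :
  symbolic_mnm m k -> mono_span (mem (variables ++ veronese_gens)) m k.
Proof.
have subv : {subset variables <= variables ++ veronese_gens}.
  by move=> g; rewrite mem_cat => ->.
have [N] := ubnP k; elim: N k m => // N IH k m kN mk.
have [->|k0] := posnP k; first exact: mono_span_variables.
set S := mnm_supp m.
have dS : d <= #|S| by apply: symbolic_supp => T cT; have := mk T cT; lia.
have [A [AS dA qk mA]] : exists A : {set 'I_n}, [/\ A \subset S, d <= #|A|,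
    (#|A| - d).+1 <= k & symbolic_mnm (m - mesym1 A)%MM (k - (#|A| - d).+1)].
  have [qk|kq] := leqP (#|S| - d).+1 k.
    by exists S; split=> //; apply: symbolic_peel.
  have [|A AS cA] := @subset_of_card _ S (d + k).-1; first by lia.
  exists A; split; rewrite ?cA //; try lia.
  by have -> : k - ((d + k).-1 - d).+1 = 0 by lia.
rewrite -(submK (mesym1_le AS)) addmC -(subnKC qk).
apply: (@mono_span_cons _ (mesym1 A, _)); last by apply: IH => //; lia.
by rewrite mem_cat; apply/orP; right; apply/veronese_gensP; exists A.
Qed.

Lemma veronese_span_symbolic m k :
  mono_span (mem (variables ++ veronese_gens)) m k -> symbolic_mnm m k.
Proof.
apply: mono_span_min => //; first by move=> *; apply: symbolic_mnmD.
move=> g; rewrite mem_cat => /orP[/variablesP[i ->] //|].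
by case/veronese_gensP=> A dA ->; apply: symbolic_mesym1.
Qed.

Hypothesis d0 : 0 < d.

(** The squarefree generators satisfy deg <= d q, so a monomial of larger
    degree needs a variable in its factorization. *)
Lemma symbolic_large_deg m k : symbolic_mnm m k -> d * k < mdeg m ->
  exists i u, m = (U_(i) + u)%MM /\ symbolic_mnm u k.
Proof.
move/symbolic_mnm_span; elim=> [|g {}m {}k gG mk IH]; first by rewrite mdeg0; lia.
move: gG; rewrite mem_cat => /orP[/variablesP[i ->] _|].
  by exists i, m; split=> //=; apply: veronese_span_symbolic.
case/veronese_gensP=> A dA ->; rewrite mdegD mdeg_mesym1 /= => lt.
have [|i [u [-> uk]]] := IH; first by nia.
exists i, (mesym1 A + u)%MM; split; first by rewrite !addmA [X in (X + u)%MM]addmC.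
by apply: symbolic_mnmD => //; apply: symbolic_mesym1.
Qed.

Definition spans_symbolic gens : Prop :=
  forall m k, symbolic_mnm m k <-> mono_span (mem gens) m k.

(** If deg u > d q then u = x_i v with v t^q in the Rees algebra. The
    factorization of v t^q cannot involve u t^q, for degree reasons, so u t^q
    is redundant. *)
Lemma minimal_gen_mdeg gens u q : {subset variables <= gens} ->
  spans_symbolic gens ->
  (forall s, subseq s gens -> spans_symbolic s -> s = gens) ->
  0 < q -> (u, q) \in gens -> mdeg u <= d * q.
Proof.
move=> sub spg ming q0 uG; rewrite leqNgt; apply/negP=> lt.
have [i [v [/= uv vq]]] := symbolic_large_deg ((spg _ _).2 (mono_span_mem uG)) lt.
pose s := [seq g <- gens | g != (u, q)].
have sE : [pred g in gens | g != (u, q)] =i s.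
  by move=> g; rewrite mem_filter inE andbC.
suff sps : spans_symbolic s.
  have := ming s (filter_subseq _ _) sps => e; move: uG.
  by rewrite -e mem_filter eqxx.
move=> m k; split=> [/spg|mk]; last first.
  apply/spg; apply: mono_span_sub mk => g; rewrite mem_filter => /andP[_].
  exact: mono_span_mem.
apply: mono_span_sub => g gG; have [-> /=|ne] := eqVneq g (u, q); last first.
  by apply: mono_span_mem; rewrite mem_filter ne.
rewrite uv -[q]add0n; apply: (@mono_span_cons _ (U_(i)%MM, 0)).
  rewrite mem_filter sub ?mem_variables // andbT.
  by apply/eqP=> -[_ e]; rewrite -e in q0.
have /spg/(@mono_span_lt_mdeg _ u q) := vq.
rewrite uv mdegD mdeg1 => /(_ (ltnSn _)); rewrite -uv.
by apply: mono_span_sub => g'; rewrite sE; apply: mono_span_mem.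
Qed.

(** A squarefree monomial of degree d has t-degree 1, so its factorization has
    exactly one factor of positive t-degree. *)
Lemma gens_deg1 gens : spans_symbolic gens ->
  exists2 u, (u, 1) \in gens & d <= mdeg u.
Proof.
move=> spg.
have [A _ cA] := @subset_of_card _ [set: 'I_n] d ltac:(by rewrite cardsT card_ord).
have := @symbolic_mesym1 A; rewrite cA subnn => /(_ (leqnn _)).
move=> /spg/mono_span_deg1[u [uG _]]; exists u => //.
by apply: symbolic_mdeg; apply/spg; apply: (mono_span_mem uG).
Qed.

(** A variable is only divisible by 1 and itself, so no generating list can do
    without it. *)
Lemma spans_symbolic_variables gens :
    (forall m, (m, 0) \in gens -> (m, 0) \in variables) ->
  spans_symbolic gens -> {subset variables <= gens}.
Proof.
move=> gv spg _ /variablesP[i ->].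
suff gen m k : mono_span (mem gens) m k -> m = U_(i)%MM -> k = 0 ->
    (U_(i)%MM, 0) \in gens.
  by have /spg/gen := symbolic_mnm0 U_(i)%MM; apply.
case=> [/mnmP/(_ i)|[u q] {}m {}k /= gG _]; first by rewrite mnm1E mnm0E eqxx.
move=> + /eqP; rewrite addn_eq0 => + /andP[/eqP q0 _]; move: gG.
rewrite q0 => gG; have /variablesP[j [uj]] := gv _ gG.
rewrite uj in gG * => /mnmP/(_ j); rewrite mnmDE !mnm1E eqxx.
by case: eqP => // ->.
Qed.

(** The squarefree part is chosen minimal among the sublists that generate
    together with the variables. A generating sublist of the whole retains all
    the variables, so the whole list is minimal too. *)
Lemma minimal_gens_exist : exists s,
  [/\ forall g, g \in s -> 0 < g.2, spans_symbolic (variables ++ s)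
   & forall t, subseq t (variables ++ s) -> spans_symbolic t -> t = variables ++ s].
Proof.
have spv : spans_symbolic (variables ++ veronese_gens).
  move=> m k; split; [exact: symbolic_mnm_span|exact: veronese_span_symbolic].
have [s [sv sps mins]] :=
  @minimal_subseq _ (fun s => spans_symbolic (variables ++ s)) _ spv.
have s0 g : g \in s -> 0 < g.2.
  by move=> /(mem_subseq sv)/veronese_gensP[A _ ->].
exists s; split=> // t /subseqP[b sb et] spt.
have [b1 [b2 [eb s1]]] : exists b1 b2, b = b1 ++ b2 /\ size b1 = size variables.
  exists (take (size variables) b), (drop (size variables) b).
  by rewrite cat_take_drop size_takel // sb size_cat leq_addr.
move: et; rewrite eb mask_cat // => et.
have sub : {subset variables <= t}.
  apply: spans_symbolic_variables => // m; rewrite et mem_cat => /orP[/mem_mask//|].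
  by move=> /mem_mask/s0.
have e1 : mask b1 variables = variables.
  apply/eqP; rewrite -(size_subseq_leqif (mask_subseq _ _)) eqn_leq.
  rewrite size_subseq ?mask_subseq //=; apply: uniq_leq_size.
    rewrite map_inj_uniq ?enum_uniq // => i j /(congr1 fst) /= e.
    by move/mnmP/(_ i): e; rewrite !mnm1E eqxx; case: eqP.
  move=> g gv; have := sub _ gv; rewrite et mem_cat => /orP[//|].
  by move=> /mem_mask/s0; case/variablesP: gv => i ->.
rewrite et e1 in spt *; congr (_ ++ _); apply: mins => //.
exact: mask_subseq.
Qed.

End Exponents.

(** * Generated ideals and localization *)

Section Ideals.

Import GRing.Theory.
Local Open Scope ring_scope.

Section Generated.

Variables (R : comNzRingType) (G : R -> Prop).

Lemma ideal_gen_min (P : R -> Prop) : P 0 -> (forall a b, P a -> P b -> P (a + b)) ->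
  (forall r a, G a -> P (r * a)) -> forall f, ideal_gen G f -> P f.
Proof.
move=> P0 PD PM f [s [sG ->]]; rewrite big_seq.
by elim/big_ind: _ => // p /sG[_]; apply: PM.
Qed.

Lemma ideal_gen_mul r g : G g -> ideal_gen G (r * g).
Proof.
move=> Gg; exists [:: (r, g)]; split=> [p|]; last by rewrite big_seq1.
by rewrite inE => /eqP->.
Qed.

Lemma ideal_genD a b : ideal_gen G a -> ideal_gen G b -> ideal_gen G (a + b).
Proof.
move=> [s [sG ->]] [t [tG ->]]; exists (s ++ t); rewrite big_cat; split=> // p.
by rewrite mem_cat => /orP[/sG|/tG].
Qed.

Lemma ideal_gen0 : ideal_gen G 0.
Proof. by exists [::]; rewrite big_nil. Qed.

Lemma ideal_genM r a : ideal_gen G a -> ideal_gen G (r * a).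
Proof.
move: a; apply: ideal_gen_min; first by rewrite mulr0; apply: ideal_gen0.
- by move=> a b Ga Gb; rewrite mulrDr; apply: ideal_genD.
by move=> r' a Ga; rewrite mulrA; apply: ideal_gen_mul.
Qed.

Lemma ideal_gen_sum (I : eqType) (s : seq I) (F : I -> R) :
  (forall i, i \in s -> ideal_gen G (F i)) -> ideal_gen G (\sum_(i <- s) F i).
Proof.
move=> GF; rewrite big_seq; elim/big_ind: _ => //; first exact: ideal_gen0.
exact: ideal_genD.
Qed.

End Generated.

(** Clearing denominators in the fraction field. *)
Lemma contraction_extension (R : idomainType) (P G : R -> Prop) f :
    is_prime_ideal P ->
  extension P (ideal_gen G) (tofrac f) <-> exists2 s, ~ P s & ideal_gen G (s * f).
Proof.
case=> P0 PD PM P1 Pprime; split=> [[t [tG]]|[s Ps Gsf]]; last first.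
  have s0 : s != 0 by apply: contra_notN Ps => /eqP->.
  exists [:: (tofrac 1 / tofrac s, tofrac (s * f))]; split=> [p|].
    rewrite inE => /eqP-> /=; split; last by exists (s * f).
    by exists 1, s.
  rewrite big_seq1 /= tofrac1 tofracM mul1r mulKf //.
  by rewrite tofrac_eq0.
suff [s Ps [b Gb eb]] : exists2 s, ~ P s & exists2 b, ideal_gen G b &
    tofrac s * \sum_(p <- t) p.1 * p.2 = tofrac b.
  by move=> ef; exists s => //; move: eb; rewrite -ef -tofracM => /eqP;
     rewrite tofrac_eq => /eqP->.
elim: t tG => [|[y z] t IH] tG.
  by exists 1 => //; exists 0; [exact: ideal_gen0|rewrite big_nil mulr0 tofrac0].
have [|s Ps [b Gb eb]] := IH; first by move=> p pt; apply: tG; rewrite inE pt orbT.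
have [[a [s' [Ps' /= ->]]] [b' Gb' /= ->]] := tG (y, z) (mem_head _ _).
exists (s * s'); first by case/Pprime.
exists (s * a * b' + s' * b); first by apply: ideal_genD; apply: ideal_genM.
have s'0 : tofrac s' != 0.
  by rewrite tofrac_eq0; apply: contra_notN Ps' => /eqP->.
by rewrite big_cons /= tofracD !tofracM -eb; field.
Qed.

(** The coefficient of index j in p * q is p`_0 * q`_j plus multiples of earlier
    coefficients of q. *)
Lemma low_coef_mul (R : idomainType) (p q : {poly R}) k : p`_0 != 0 ->
  (forall j, (j < k)%N -> (p * q)`_j = 0) -> forall j, (j < k)%N -> q`_j = 0.
Proof.
move=> p0 pq0 j; elim/ltn_ind: j => j IH jk.
have /eqP := pq0 j jk; rewrite coefM big_ord_recl subn0 big1 => [|i _].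
  by rewrite addr0 mulf_eq0 (negPf p0) => /eqP.
by rewrite [X in _ * X]IH ?mulr0 //=; case: i => i /=; rewrite /bump; lia.
Qed.

End Ideals.

(** * Symbolic powers of the squarefree Veronese ideal *)

Section Support.

Import GRing.Theory.
Local Open Scope ring_scope.

Variables (K : fieldType) (n : nat).
Implicit Types (f g : {mpoly K[n]}) (T : {set 'I_n}) (P Q : 'X_{1..n} -> Prop).

Definition supported P f : Prop := forall m, m \in msupp f -> P m.

Lemma supported0 P : supported P 0.
Proof. by move=> m; rewrite msupp0. Qed.

Lemma supportedD P f g : supported P f -> supported P g -> supported P (f + g).
Proof. by move=> Pf Pg m /msuppD_le; rewrite mem_cat => /orP[/Pf|/Pg]. Qed.

Lemma supportedM P Q (R : 'X_{1..n} -> Prop) f g :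
    (forall m u, P m -> Q u -> R (m + u)%MM) ->
  supported P f -> supported Q g -> supported R (f * g).
Proof.
move=> PQR Pf Qg m /msuppM_le/allpairsP[[u v] /= [/Pf Pu /Qg Qv ->]].
exact: PQR.
Qed.

Lemma supportedX P m : supported P 'X_[m] <-> P m.
Proof.
split=> [|Pm u]; first by apply; rewrite msuppX inE.
by rewrite msuppX inE => /eqP->.
Qed.

(** [order_ge T k f] is membership of f in the k-th power of P_T; in particular
    [order_ge T 1] is P_T itself. *)
Definition order_ge (T : {set 'I_n}) k f : Prop :=
  supported (fun m => k <= setdeg T m)%N f.

Lemma order_ge_prod T k (a : 'I_k -> {mpoly K[n]}) :
  (forall i, order_ge T 1 (a i)) -> order_ge T k (\prod_(i < k) a i).
Proof.
elim: k a => [|k IH] a a1; first by move=> m.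
rewrite big_ord_recl; apply: supportedM (a1 _) (IH _ _) => [m u|i] //.
by rewrite setdegD; lia.
Qed.

(** The substitution x_i -> x_i t for i in T. The coefficient of t^j is the
    component of T-degree j, so that T-order becomes order at t = 0. *)
Definition grade T : {mpoly K[n]} -> {poly {mpoly K[n]}} :=
  mmap (polyC \o @mpolyC n K) (fun i => ('X_i)%:P * 'X^(i \in T)).

Lemma grade_coef T f j m :
  ((grade T f)`_j)@_m = if j == setdeg T m then f@_m else 0.
Proof.
rewrite /grade {1}/mmap coef_sum raddf_sum /=.
have mmapE u : mmap1 (fun i => ('X_i)%:P * 'X^(i \in T)) u
    = ('X_[u])%:P * 'X^(setdeg T u) :> {poly {mpoly K[n]}}.
  rewrite /mmap1; transitivity (\prod_(i < n)
      (('X_i ^+ u i)%:P * 'X^(if i \in T then u i else 0%N)) :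
      {poly {mpoly K[n]}}).
    apply: eq_bigr => i _; rewrite exprMn -exprM rmorphXn.
    by case: (i \in T); rewrite ?mul1n ?mul0n.
  by rewrite big_split mpolyXE_id rmorph_prod prodrXr -big_mkcond.
transitivity (\sum_(u <- msupp f) f@_u * ((u == m)%:R * (j == setdeg T u)%:R)).
  apply: eq_bigr => u _; rewrite mmapE !coefCM coefXn mcoeffCM.
  by case: (j == setdeg T u); rewrite ?mulr1 ?mulr0 ?mcoeffX ?mcoeff0 ?mulr0.
have [mf|mf] := boolP (m \in msupp f).
  rewrite (bigD1_seq m) //= ?msupp_uniq // eqxx mul1r big1 => [|u /negPf->].
    by rewrite addr0; case: eqP; rewrite ?mulr1 ?mulr0.
  by rewrite mul0r mulr0.
rewrite memN_msupp_eq0 // if_same big_seq big1 // => u uf.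
by case: eqP mf => [<-|]; rewrite ?uf // mul0r mulr0.
Qed.

Lemma order_geP T k f :
  order_ge T k f <-> forall j, (j < k)%N -> (grade T f)`_j = 0.
Proof.
split=> [fk j jk|f0 m mf].
  apply/mpolyP=> m; rewrite grade_coef mcoeff0; case: eqP => // ej.
  by apply: memN_msupp_eq0; apply/negP=> /fk; rewrite -ej leqNgt jk.
rewrite leqNgt; apply/negP=> /f0/(congr1 (mcoeff m)).
by rewrite grade_coef eqxx mcoeff0 => /eqP; rewrite mcoeff_eq0 mf.
Qed.

Lemma gradeM T f g : grade T (f * g) = grade T f * grade T g.
Proof. exact: rmorphM. Qed.

(** The powers of P_T are primary. *)
Lemma order_ge_cancel T k s f : ~ order_ge T 1 s -> order_ge T k (s * f) ->
  order_ge T k f.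
Proof.
move=> s1 /order_geP; rewrite gradeM => sf; apply/order_geP.
apply: low_coef_mul sf; apply/eqP => s0; apply: s1; apply/order_geP.
by case.
Qed.

Lemma order_ge1_prime T : is_prime_ideal (order_ge T 1).
Proof.
split.
- exact: supported0.
- exact: supportedD.
- move=> r a; apply: (@supportedM xpredT) => // m u _.
  by rewrite setdegD; lia.
- by rewrite -mpolyX0 => /supportedX; rewrite setdeg0.
move=> a b ab; case: (classic (order_ge T 1 a)) => a1; [by left|right].
exact: order_ge_cancel ab.
Qed.

Variable d : nat.
Hypothesis dn : (d <= n)%N.
Local Notation J := (@squarefree_veronese K n d).

Lemma squarefree_veroneseP f : J f <-> supported (fun m => symbolic_mnm d m 1) f.
Proof.
split=> [|f1].
  apply: ideal_gen_min; [exact: supported0|by move=> *; apply: supportedD|].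
  move=> r _ [m [dm sqm ->]].
  apply: (@supportedM xpredT (fun m => symbolic_mnm d m 1)) => //.
    by move=> u v _ v1; apply: (@symbolic_mnmD _ _ _ _ 0%N).
  apply/supportedX; move: dm; rewrite (squarefree_mesym1 sqm) mdeg_mesym1 => cA.
  have := @symbolic_mesym1 _ d dn (mnm_supp m).
  by rewrite cA subnn; apply.
rewrite [f]mpolyE; apply: ideal_gen_sum => m /f1/(symbolic_supp dn) dm.
have [A sA cA] := subset_of_card dm.
rewrite -(submK (mesym1_le sA)) mpolyXD scalerAl; apply: ideal_gen_mul.
exists (mesym1 A); split=> //; first by rewrite mdeg_mesym1.
by move=> i; rewrite mnmE leq_b1.
Qed.

Lemma squarefree_veronese_order f :
  J f <-> forall T : {set 'I_n}, #|T| = (n - d).+1 -> order_ge T 1 f.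
Proof.
split=> [/squarefree_veroneseP f1 T cT m /f1|f1]; first exact.
by apply/squarefree_veroneseP => m mf T cT; apply: f1.
Qed.

Lemma ideal_power_order T k f : #|T| = (n - d).+1 ->
  ideal_power J k f -> order_ge T k f.
Proof.
move=> cT; apply: ideal_gen_min; [exact: supported0|by move=> *; apply: supportedD|].
move=> r _ [a [Ja ->]]; apply: (@supportedM xpredT (fun m => k <= setdeg T m)%N).
- by move=> m u _; rewrite setdegD; lia.
- by [].
by apply: order_ge_prod => i; move/squarefree_veronese_order: (Ja i); apply.
Qed.

Hypothesis d0 : (0 < d)%N.

Lemma card_transversalC T : #|T| = (n - d).+1 -> #|~: T| = d.-1.
Proof. by move=> cT; have := cardsC T; rewrite card_ord; lia. Qed.

(** P_T is the annihilator modulo I of the product of the d - 1 variables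
    outside T: every other T' of the same size meets the complement of T. *)
Lemma order_associated (T : {set 'I_n}) : #|T| = (n - d).+1 ->
  associated_prime J (order_ge T 1).
Proof.
move=> cT; split; first exact: order_ge1_prime.
exists 'X_[mesym1 (~: T)] => g; split=> [g1|].
  apply/squarefree_veronese_order => T' cT'.
  have [->|ne] := eqVneq T' T.
    apply: (@supportedM _ xpredT _ _ _ _ g1) => // m u m1 _.
    by rewrite setdegD; lia.
  apply: (@supportedM xpredT (fun m => 0 < setdeg T' m)%N) => //.
    by move=> m u _; rewrite setdegD; lia.
  apply/supportedX; rewrite setdeg_mesym1 -setDE lt0n cards_eq0 setD_eq0.
  by apply: contraNN ne => sT; rewrite eqEcard sT cT cT' leqnn.
move/squarefree_veronese_order/(_ T cT); rewrite mulrC.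
by apply: order_ge_cancel => /supportedX; rewrite setdeg_mesym1 setICr cards0.
Qed.

Lemma mnm_choose (T : {set 'I_n}) k m : (k <= setdeg T m)%N ->
  exists2 a : 'I_k -> 'I_n, (forall j, a j \in T) & (\sum_(j < k) U_(a j) <= m)%MM.
Proof.
elim: k m => [|k IH] m km.
  have i0 : 'I_0 -> 'I_n by case.
  exists i0; first by case.
  by rewrite big_ord0; apply/mnm_lepP => i; rewrite mnm0E.
have [i /andP[iT mi]] : exists i, (i \in T) && (0 < m i)%N.
  apply/existsP; apply: contraLR km; rewrite negb_exists => /forallP m0.
  rewrite -ltnNge /setdeg big1 // => j jT; have := m0 j; rewrite jT /=; lia.
have Um : (U_(i) <= m)%MM by rewrite lep1mP -lt0n.
have [|a aT am] := IH (m - U_(i))%MM.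
  by move: km; rewrite -{1}(submK Um) setdegD setdegU iT; lia.
exists (fun j => if unlift ord0 j is Some j' then a j' else i).
  by move=> j; case: unlift.
rewrite big_ord_recl unlift_none.
under eq_bigr => j _ do rewrite liftK.
apply/mnm_lepP => l; move/mnm_lepP/(_ l): am; move/mnm_lepP/(_ l): Um.
by rewrite mnmDE mnmBE => Ul; rewrite -leq_subRL.
Qed.

(** With w the product of the d - 1 variables outside T, every x_i w with i in T
    is a generator of I; so k factors w turn k variables of T dividing m into k
    elements of I. As w is outside P_T, this puts m in the localization of I^k
    at P_T. *)
Lemma mono_ideal_power (T : {set 'I_n}) k m : #|T| = (n - d).+1 ->
  (k <= setdeg T m)%N -> ideal_power J k ('X_[mesym1 (~: T)] ^+ k * 'X_[m]).
Proof.
move=> cT /mnm_choose[a aT am]; rewrite -(submK am) mpolyXD mulrC -mulrA.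
apply: ideal_gen_mul; exists (fun j => 'X_(a j) * 'X_[mesym1 (~: T)]); split.
  move=> j; rewrite -mpolyXD; rewrite -[X in squarefree_veronese _ X]mul1r.
  apply: ideal_gen_mul; exists (mesym1 (a j |: ~: T)); split.
  - rewrite mdeg_mesym1 cardsU1 inE aT /=.
    by rewrite card_transversalC // add1n prednK.
  - by move=> i; rewrite mnmE leq_b1.
  congr 'X_[_]; apply/mnmP=> i; rewrite mnmDE mnm1E !mnmE !inE.
  have := aT j; rewrite (eq_sym i).
  by case: eqP => [->|]; [move=> ->|case: (i \in T)].
by rewrite big_split prodr_const card_ord /= mprodXE.
Qed.

(** An associated prime P = (I : g) is proper, so g is outside some P_T, and
    then P is contained in P_T. The denominators w ^+ k that put f in the
    localization of I^k at P_T are thus invertible at P as well. *)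
Lemma symbolic_powerP k f :
  symbolic_power J k f <-> supported (fun m => symbolic_mnm d m k) f.
Proof.
split=> [fk m mf T cT|fk P].
  have ass := order_associated cT; have [pr _] := ass.
  have /(contraction_extension _ _ pr)[s s1 /(ideal_power_order cT) sf] := fk _ ass.
  exact: order_ge_cancel s1 sf m mf.
move=> [pr [g Pg]]; apply/contraction_extension => //.
have [T cT gT] : exists2 T : {set 'I_n}, #|T| = (n - d).+1 & ~ order_ge T 1 g.
  apply: NNPP => noT; case: pr => _ _ _ + _; apply; apply/Pg; rewrite mul1r.
  apply/squarefree_veronese_order => T cT; apply: NNPP => gT.
  by apply: noT; exists T.
have PT h : P h -> order_ge T 1 h.
  move/Pg/squarefree_veronese_order/(_ T cT); rewrite mulrC.
  exact: order_ge_cancel.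
exists ('X_[mesym1 (~: T)] ^+ k).
  move/PT; rewrite mpolyXn => /supportedX; rewrite /setdeg big1 // => i iT.
  by rewrite mulmnE mnmE inE iT.
rewrite [f]mpolyE mulr_sumr; apply: ideal_gen_sum => m /fk mk.
by rewrite -scalerAr -mul_mpolyC; apply: ideal_genM; apply: mono_ideal_power (mk T cT).
Qed.

Lemma symbolic_reesP (F : {poly {mpoly K[n]}}) :
  symbolic_rees J F <-> forall k, supported (fun m => symbolic_mnm d m k) F`_k.
Proof. by split=> FJ k; apply/symbolic_powerP. Qed.

(** * Monomial generators of the symbolic Rees algebra *)

(** The polynomials supported on a submonoid of exponents form a subalgebra. *)
Lemma subalgebra_genP (gens : seq ('X_{1..n} * nat)) (F : {poly {mpoly K[n]}}) :
  subalgebra_gen (fun x => exists2 g, g \in gens & x = monomial_t K g) F <->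
  forall k, supported (fun m => mono_span (mem gens) m k) F`_k.
Proof.
split=> [|FG A [AC AD AM] Agens].
  move=> FG; apply: (FG (fun F => forall k,
    supported (fun m => mono_span (mem gens) m k) F`_k)); first split.
  - move=> c k m; rewrite coefC; case: eqP => [->|]; last by rewrite msupp0.
    by rewrite msuppC; case: ifP => // _; rewrite inE => /eqP->; apply: mono_span0.
  - by move=> F' G' AF AG k; rewrite coefD; apply: supportedD.
  - move=> F' G' AF AG k; rewrite coefM; elim/big_ind: _ => //.
    + exact: supported0.
    + by move=> *; apply: supportedD.
    move=> [i ik] _ /=; apply: supportedM (AF i) (AG (k - i)%N) => m u mi uk.
    by rewrite -(@subnKC i k) //; apply: mono_spanD.
  move=> _ [g gG ->] k; rewrite coefZ coefXn; case: eqP => [->|_].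
    by rewrite mulr1; apply/supportedX; apply: mono_span_mem.
  by rewrite mulr0; apply: supported0.
have Amono m k : mono_span (mem gens) m k -> A ('X_[m] *: 'X^k).
  elim=> [|g {}m {}k gG _ IH].
    by rewrite mpolyX0 scale1r expr0 -[1]/(1%:P) -mpolyC1; apply: AC.
  rewrite mpolyXD exprD -mul_polyC polyCM mulrACA !mul_polyC.
  by apply: AM => //; apply: Agens; exists g.
have A0 : A 0 by have := AC 0; rewrite mpolyC0 polyC0.
rewrite -[F]coefK poly_def; elim/big_ind: _ => // -[k _] _ /=.
rewrite [F`_k]mpolyE scaler_suml big_seq; elim/big_ind: _ => // m mF.
rewrite -mul_mpolyC -scalerA -mul_polyC; apply: AM; first exact: AC.
exact/Amono/FG.
Qed.

Lemma generates_reesP (gens : seq ('X_{1..n} * nat)) :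
  generates_rees J gens <-> spans_symbolic d gens.
Proof.
split=> [gen m k|spg F]; last first.
  split=> [/symbolic_reesP FJ|/subalgebra_genP FG].
    by apply/subalgebra_genP => k m /FJ/spg.
  by apply/symbolic_reesP => k m /FG/spg.
have E (P : 'X_{1..n} -> nat -> Prop) :
    (forall j, supported (P^~ j) ('X_[m] *: 'X^k : {poly {mpoly K[n]}})`_j) <-> P m k.
  split=> [/(_ k)|Pmk j]; rewrite coefZ coefXn.
    by rewrite eqxx mulr1 => /supportedX.
  case: eqP => [->|_]; first by rewrite mulr1; apply/supportedX.
  by rewrite mulr0; apply: supported0.
have := gen ('X_[m] *: 'X^k).
by rewrite symbolic_reesP subalgebra_genP !E.
Qed.

End Support.

(** * The symbolic degree *)

(** Every minimal generating list has to be treated, because [symbolic_degree]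
    does not reveal which one its choice refers to. *)
Lemma minimal_rees_maximum (K : fieldType) n d k (m : nat)
    (u : 'I_m -> 'X_{1..n}) (q : 'I_m -> nat) : 0 < d -> d <= n ->
    (forall j, 0 < q j) ->
    minimal_rees_generators (@squarefree_veronese K n d)
      (variables n ++ [seq (u j, q j) | j <- enum 'I_m]) ->
  is_maximum (fun w => exists c : 'I_m -> nat,
    \sum_(j < m) c j * q j <= k /\ w = \sum_(j < m) c j * mdeg (u j)) (d * k).
Proof.
set gens := _ ++ _ => d0 dn q0 [gen ming].
have spg : spans_symbolic d gens by apply/(generates_reesP K dn d0).
have sub : {subset variables n <= gens} by move=> g; rewrite mem_cat => ->.
have ujG j : (u j, q j) \in gens.
  by rewrite mem_cat map_f ?orbT // mem_enum.
have degu j : mdeg (u j) <= d * q j.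
  apply: (minimal_gen_mdeg dn d0 sub spg) => // s ss sps.
  by apply: ming => //; apply/(generates_reesP K dn d0).
have upper (c : 'I_m -> nat) : \sum_(j < m) c j * q j <= k ->
    \sum_(j < m) c j * mdeg (u j) <= d * k.
  move=> cq; apply: leq_trans (leq_mul (leqnn d) cq); rewrite big_distrr /=.
  by apply: leq_sum => j _; rewrite mulnCA leq_mul2l degu orbT.
split=> [|_ [c [cq ->]]]; last exact: upper.
have [w wG dw] := gens_deg1 dn spg.
have [j [uj qj]] : exists j, w = u j /\ q j = 1.
  move: wG; rewrite mem_cat => /orP[/variablesP[i]//|/mapP[j _ [-> ->]]].
  by exists j.
pose c i := if i == j then k else 0.
have sumc (F : 'I_m -> nat) : \sum_i c i * F i = k * F j.
  by rewrite (bigD1 j) //= /c eqxx big1 ?addn0 // => i /negPf->.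
have cq : \sum_i c i * q i <= k by rewrite sumc qj muln1.
exists c; split=> //; apply/eqP; rewrite eqn_leq upper // andbT.
by rewrite sumc -uj mulnC leq_mul2l dw orbT.
Qed.

Lemma symbolic_degree_exists (K : fieldType) n d k : 0 < d -> d <= n ->
  is_symbolic_degree (@squarefree_veronese K n d) k (d * k).
Proof.
move=> d0 dn; have [s [s0 sps mins]] := minimal_gens_exist dn.
pose u (j : 'I_(size s)) := (tnth (in_tuple s) j).1.
pose q (j : 'I_(size s)) := (tnth (in_tuple s) j).2.
have es : [seq (u j, q j) | j <- enum 'I_(size s)] = s.
  rewrite -[RHS](map_tnth_enum (in_tuple s)); apply: eq_map => j.
  by rewrite /u /q -surjective_pairing.
have q0 j : 0 < q j by apply: s0; apply: mem_tnth.
have mg : minimal_rees_generators (@squarefree_veronese K n d)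
    (variables n ++ [seq (u j, q j) | j <- enum 'I_(size s)]).
  rewrite es; split=> [|t ts]; first exact/(generates_reesP K dn d0).
  by move/(generates_reesP K dn d0); apply: mins.
exists (size s), u, q; split=> //.
exact: minimal_rees_maximum mg.
Qed.

Theorem corollary3p1 (K : fieldType) (n d : nat) (hd : 1 <= d) (hdn : d <= n)
    (k : nat) (hk : 1 <= k) :
  symbolic_degree (@squarefree_veronese K n d) k = d * k.
Proof.
have ex : exists v, is_symbolic_degree (@squarefree_veronese K n d) k v.
  by exists (d * k); apply: symbolic_degree_exists.
have [m [u [q [q0 mg [vA vmax]]]]] := epsilon_spec (inhabits 0) _ ex.
have [dkA dkmax] := minimal_rees_maximum k hd hdn q0 mg.
by apply/eqP; rewrite eqn_leq vmax // dkmax.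
Qed.
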